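(* Let $\mathbb{F}$ be an algebraically closed field. Every indecomposable pair $(A,B)$ of commuting nilpotent $4\times 4$ matrices over $\mathbb{F}$ is similar (under simultaneous similarity) to a unique pair in one of the following forms, where $\lambda,\mu,\nu\in\mathbb{F}$ (that is, among all pairs obtained from the forms below by letting the parameters occurring in them range over $\mathbb{F}$, there is exactly one that is similar to $(A,B)$): (1.1) $\left(\begin{bmatrix}0&1&0&0\\0&0&1&0\\0&0&0&1\\0&0&0&0\end{bmatrix},\ \begin{bmatrix}0&\lambda&\mu&\nu\\0&0&\lambda&\mu\\0&0&0&\lambda\\0&0&0&0\end{bmatrix}\right)$, (2.1) $\left(\begin{bmatrix}0&1&0&0\\0&0&1&0\\0&0&0&0\\0&0&0&0\end{bmatrix},\ \begin{bmatrix}0&\lambda&0&\mu\\0&0&\lambda&0\\0&0&0&0\\0&0&1&0\end{bmatrix}\right)$, (2.2) $\left(\begin{bmatrix}0&1&0&0\\0&0&1&0\\0&0&0&0\\0&0&0&0\end{bmatrix},\ \begin{bmatrix}0&\lambda&0&1\\0&0&\lambda&0\\0&0&0&0\\0&0&0&0\end{bmatrix}\right)$, (3.1) $\left(\begin{bmatrix}0&1&0&0\\0&0&0&0\\0&0&0&1\\0&0&0&0\end{bmatrix},\ \begin{bmatrix}0&0&1&0\\0&0&0&1\\0&\lambda&0&\mu\\0&0&0&0\end{bmatrix}\right)$, (3.2) $\left(\begin{bmatrix}0&1&0&0\\0&0&0&0\\0&0&0&1\\0&0&0&0\end{bmatrix},\ \begin{bmatrix}0&\lambda&0&1\\0&0&0&0\\0&0&0&\lambda\\0&0&0&0\end{bmatrix}\right)$,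 (4.1) $\left(\begin{bmatrix}0&1&0&0\\0&0&0&0\\0&0&0&0\\0&0&0&0\end{bmatrix},\ \begin{bmatrix}0&0&\lambda&0\\0&0&0&0\\0&0&0&1\\0&1&0&0\end{bmatrix}\right)$, (4.2) $\left(\begin{bmatrix}0&1&0&0\\0&0&0&0\\0&0&0&0\\0&0&0&0\end{bmatrix},\ \begin{bmatrix}0&0&1&0\\0&0&0&0\\0&0&0&1\\0&0&0&0\end{bmatrix}\right)$, (4.3) $\left(\begin{bmatrix}0&1&0&0\\0&0&0&0\\0&0&0&0\\0&0&0&0\end{bmatrix},\ \begin{bmatrix}0&0&1&0\\0&0&0&0\\0&0&0&0\\0&1&0&0\end{bmatrix}\right)$, (5.1) $\left(\begin{bmatrix}0&0&0&0\\0&0&0&0\\0&0&0&0\\0&0&0&0\end{bmatrix},\ \begin{bmatrix}0&1&0&0\\0&0&1&0\\0&0&0&1\\0&0&0&0\end{bmatrix}\right)$.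
   Context: Let $\mathbb{F}$ be a field. A pair $(A,B)$ of $n\times n$ matrices over $\mathbb{F}$ is similar to another pair $(C,D)$ of $n\times n$ matrices over $\mathbb{F}$ if there exists a non-singular matrix $X$ over $\mathbb{F}$ such that $X^{-1}AX=C$ and $X^{-1}BX=D$ (the same $X$ for both). A commuting nilpotent pair is a pair $(A,B)$ with $A^n=0$, $B^n=0$ and $AB=BA$. A pair $(A,B)$ is decomposable if it is similar to a pair of the block-diagonal form $\left(\begin{bmatrix}A_1&0\\0&A_2\end{bmatrix},\begin{bmatrix}B_1&0\\0&B_2\end{bmatrix}\right)$, where $A_1$ and $B_1$ are square matrices of the same size, $A_2$ and $B_2$ are square matrices of the same size, and both sizes are at least $1$. For $n\geq 1$, a pair of $n\times n$ matrices is indecomposable if it is not decomposable. *)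

(* Defs.v *)
From mathcomp Require Import all_boot all_order all_algebra.

Set Implicit Arguments.
Unset Strict Implicit.
Unset Printing Implicit Defensive.

Import GRing.Theory.
Local Open Scope ring_scope.

Definition mxpair (F : fieldType) (n : nat) : Type := ('M[F]_n * 'M[F]_n)%type.

Definition pair_similar (F : fieldType) (n : nat) (P Q : mxpair F n) : Prop :=
  exists X : 'M[F]_n,
    [/\ X \in unitmx,
        invmx X *m P.1 *m X = Q.1
      & invmx X *m P.2 *m X = Q.2].

Definition commuting_nilpotent_pair (F : fieldType) (n : nat)
    (P : mxpair F n) : Prop :=
  [/\ P.1 ^+ n = 0, P.2 ^+ n = 0 & P.1 *m P.2 = P.2 *m P.1].

Definition decomposable_pair (F : fieldType) (n : nat) (P : mxpair F n) : Prop :=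
  exists (n1 n2 : nat) (e : (n1 + n2)%N = n)
         (A1 B1 : 'M[F]_n1) (A2 B2 : 'M[F]_n2),
    [/\ (0 < n1)%N,
        (0 < n2)%N
      & pair_similar P (castmx (e, e) (block_mx A1 0 0 A2),
                        castmx (e, e) (block_mx B1 0 0 B2))].

Definition indecomposable_pair (F : fieldType) (n : nat) (P : mxpair F n) : Prop :=
  (0 < n)%N /\ ~ decomposable_pair P.

Definition mx4 (F : fieldType) (rows : seq (seq F)) : 'M[F]_4 :=
  \matrix_(i < 4, j < 4) nth 0 (nth [::] rows i) j.

Inductive canonical_pair (F : fieldType) : mxpair F 4 -> Prop :=
| form_1_1 (lambda mu nu : F) : canonical_pair
    (mx4 [:: [:: 0; 1; 0; 0];
             [:: 0; 0; 1; 0];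
             [:: 0; 0; 0; 1];
             [:: 0; 0; 0; 0]],
     mx4 [:: [:: 0; lambda; mu; nu];
             [:: 0; 0; lambda; mu];
             [:: 0; 0; 0; lambda];
             [:: 0; 0; 0; 0]])
| form_2_1 (lambda mu : F) : canonical_pair
    (mx4 [:: [:: 0; 1; 0; 0];
             [:: 0; 0; 1; 0];
             [:: 0; 0; 0; 0];
             [:: 0; 0; 0; 0]],
     mx4 [:: [:: 0; lambda; 0; mu];
             [:: 0; 0; lambda; 0];
             [:: 0; 0; 0; 0];
             [:: 0; 0; 1; 0]])
| form_2_2 (lambda : F) : canonical_pair
    (mx4 [:: [:: 0; 1; 0; 0];
             [:: 0; 0; 1; 0];
             [:: 0; 0; 0; 0];
             [:: 0; 0; 0; 0]],
     mx4 [:: [:: 0; lambda; 0; 1];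
             [:: 0; 0; lambda; 0];
             [:: 0; 0; 0; 0];
             [:: 0; 0; 0; 0]])
| form_3_1 (lambda mu : F) : canonical_pair
    (mx4 [:: [:: 0; 1; 0; 0];
             [:: 0; 0; 0; 0];
             [:: 0; 0; 0; 1];
             [:: 0; 0; 0; 0]],
     mx4 [:: [:: 0; 0; 1; 0];
             [:: 0; 0; 0; 1];
             [:: 0; lambda; 0; mu];
             [:: 0; 0; 0; 0]])
| form_3_2 (lambda : F) : canonical_pair
    (mx4 [:: [:: 0; 1; 0; 0];
             [:: 0; 0; 0; 0];
             [:: 0; 0; 0; 1];
             [:: 0; 0; 0; 0]],
     mx4 [:: [:: 0; lambda; 0; 1];
             [:: 0; 0; 0; 0];
             [:: 0; 0; 0; lambda];
             [:: 0; 0; 0; 0]])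
| form_4_1 (lambda : F) : canonical_pair
    (mx4 [:: [:: 0; 1; 0; 0];
             [:: 0; 0; 0; 0];
             [:: 0; 0; 0; 0];
             [:: 0; 0; 0; 0]],
     mx4 [:: [:: 0; 0; lambda; 0];
             [:: 0; 0; 0; 0];
             [:: 0; 0; 0; 1];
             [:: 0; 1; 0; 0]])
| form_4_2 : canonical_pair
    (mx4 [:: [:: 0; 1; 0; 0];
             [:: 0; 0; 0; 0];
             [:: 0; 0; 0; 0];
             [:: 0; 0; 0; 0]],
     mx4 [:: [:: 0; 0; 1; 0];
             [:: 0; 0; 0; 0];
             [:: 0; 0; 0; 1];
             [:: 0; 0; 0; 0]])
| form_4_3 : canonical_pair
    (mx4 [:: [:: 0; 1; 0; 0];
             [:: 0; 0; 0; 0];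
             [:: 0; 0; 0; 0];
             [:: 0; 0; 0; 0]],
     mx4 [:: [:: 0; 0; 1; 0];
             [:: 0; 0; 0; 0];
             [:: 0; 0; 0; 0];
             [:: 0; 1; 0; 0]])
| form_5_1 : canonical_pair
    (mx4 [:: [:: 0; 0; 0; 0];
             [:: 0; 0; 0; 0];
             [:: 0; 0; 0; 0];
             [:: 0; 0; 0; 0]],
     mx4 [:: [:: 0; 1; 0; 0];
             [:: 0; 0; 1; 0];
             [:: 0; 0; 0; 1];
             [:: 0; 0; 0; 0]]).

(* Main.v *)
Require Import Defs.
From mathcomp Require Import all_boot all_order all_algebra.
From mathcomp Require Import ring.

Import GRing.Theory.
Local Open Scope ring_scope.

(** Bring [A] to its nilpotent Jordan form [J], one of five matrices. After
    that [B] lies in the centralizer of [J], whose elements are block matrices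
    with few parameters, and the remaining freedom is conjugation by the
    invertible elements of that same centralizer.

    Existence ([classified_jordan4_0] to [classified_jordan4_4]). For each [J]
    the part of [B] that acts on the tops of the Jordan blocks of a given size
    is a matrix of size at most two; over a closed field it can be given Jordan
    form ([jordan2_SL]), and nilpotency of [B] kills its eigenvalues. What is
    left is a short list of vectors and scalars. Either one of them is nonzero
    in a position which allows all inessential parameters to be cleared by an
    explicit base change, and a canonical pair appears, or they vanish and the
    pair splits into two diagonal blocks. For [J = 0] it is the Jordan form of
    [B] that decides. The base changes are exhibited together with their
    inverses up to a nonzero scalar, so that everything reduces to identities
    between entries.

    Uniqueness ([canonical_pair_unique]). An intertwiner between two different
    Jordan forms is never invertible ([jordan4_intertwiner]), so similar
    canonical pairs share their first matrix [J]. A matrix [X] conjugating one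
    to the other then lies in the centralizer of [J], and comparing a few
    entries of [C *m X = X *m D] forces the parameters of [C] and [D] to agree.

    Throughout, a base change is recorded as an equation [M *m X = X *m N]: the
    columns of [X] are the vectors of the new basis, on which [M] acts by [N].
*)

(** * Simultaneous similarity *)

Lemma pair_similar_intro {F : fieldType} {n : nat} (P Q : mxpair F n)
    (X : 'M[F]_n) :
  X \in unitmx -> P.1 *m X = X *m Q.1 -> P.2 *m X = X *m Q.2 ->
  pair_similar P Q.
Proof. by move=> uX h1 h2; exists X; rewrite -!mulmxA h1 h2 !mulKmx. Qed.

Lemma pair_similar_elim {F : fieldType} {n : nat} {P Q : mxpair F n} :
  pair_similar P Q ->
  exists X : 'M[F]_n,
    [/\ X \in unitmx, P.1 *m X = X *m Q.1 & P.2 *m X = X *m Q.2].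
Proof.
by case=> X [uX <- <-]; exists X; rewrite -!mulmxA !mulKVmx.
Qed.

Lemma pair_similar_refl {F : fieldType} {n : nat} (P : mxpair F n) :
  pair_similar P P.
Proof.
by apply: (pair_similar_intro _ _ 1%:M);
  rewrite ?unitmx1 // mulmx1 mul1mx.
Qed.

Lemma pair_similar_sym {F : fieldType} {n : nat} {P Q : mxpair F n} :
  pair_similar P Q -> pair_similar Q P.
Proof.
case/pair_similar_elim=> X [uX h1 h2].
apply: (@pair_similar_intro _ _ _ _ (invmx X)); first by rewrite unitmx_inv.
- by rewrite -[LHS](mulKmx uX) [X *m _]mulmxA -h1 mulmxK.
- by rewrite -[LHS](mulKmx uX) [X *m _]mulmxA -h2 mulmxK.
Qed.

Lemma pair_similar_trans {F : fieldType} {n : nat} {P Q R : mxpair F n} :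
  pair_similar P Q -> pair_similar Q R -> pair_similar P R.
Proof.
case/pair_similar_elim=> X [uX h1 h2] /pair_similar_elim[Y [uY k1 k2]].
apply: (@pair_similar_intro _ _ _ _ (X *m Y)); first by rewrite unitmx_mul uX.
- by rewrite mulmxA h1 -!mulmxA k1.
- by rewrite mulmxA h2 -!mulmxA k2.
Qed.

Lemma intertwine_exp {F : fieldType} {n : nat} {M N X : 'M[F]_n} (k : nat) :
  M *m X = X *m N -> M ^+ k *m X = X *m N ^+ k.
Proof.
move=> h; elim: k => [|k IHk]; first by rewrite !expr0 mul1mx mulmx1.
by rewrite exprSr exprS -[_ * M]/(_ *m M) -mulmxA h mulmxA IHk -mulmxA
  -[_ *m N]/(_ * N) -exprSr exprS.
Qed.

Lemma commuting_nilpotent_similar {F : fieldType} {n : nat} {P Q : mxpair F n} :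
  pair_similar P Q -> commuting_nilpotent_pair P -> commuting_nilpotent_pair Q.
Proof.
case/pair_similar_elim=> X [uX h1 h2] [n1 n2 c].
have cancel (M N : 'M[F]_n) : X *m M = X *m N -> M = N.
  by move=> e; rewrite -[M](mulKmx uX) e mulKmx.
split; apply: cancel.
- by rewrite -(intertwine_exp n h1) n1 mul0mx mulmx0.
- by rewrite -(intertwine_exp n h2) n2 mul0mx mulmx0.
- by rewrite !mulmxA -h1 -h2 -!mulmxA -h1 -h2 !mulmxA c.
Qed.

(** Indices are [n1 + n2] on both sides, so the cast in the definition of a
    decomposable pair is the identity. *)
Lemma block_diagonal_decomposable {F : fieldType} (n1 n2 : nat)
    (P Q : mxpair F (n1 + n2)) :
  (0 < n1)%N -> (0 < n2)%N -> pair_similar P Q ->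
  ursubmx Q.1 = 0 -> dlsubmx Q.1 = 0 -> ursubmx Q.2 = 0 -> dlsubmx Q.2 = 0 ->
  decomposable_pair P.
Proof.
case: Q => C D /= n1_gt0 n2_gt0 PQ ur1 dl1 ur2 dl2.
exists n1, n2, (erefl _), (ulsubmx C), (ulsubmx D), (drsubmx C), (drsubmx D).
have blockE (M : 'M[F]_(n1 + n2)) : ursubmx M = 0 -> dlsubmx M = 0 ->
    block_mx (ulsubmx M) 0 0 (drsubmx M) = M.
  by move=> ur dl; rewrite -[RHS]submxK ur dl.
by split=> //; rewrite !castmx_id !blockE.
Qed.

(** * Calculus of explicit matrices of size four *)

Lemma mx4_eta {F : fieldType} (X : 'M[F]_4) :
  X = mx4 (mkseq (fun i => mkseq (fun j => X (inord i) (inord j)) 4) 4).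
Proof.
by apply/matrixP=> i j; rewrite mxE !nth_mkseq ?ltn_ord // !inord_val.
Qed.

Lemma mx4_ind {F : fieldType} (T : 'M[F]_4 -> Prop) :
  (forall a b c d e f g h i j k l m n o p : F,
     T (mx4 [:: [:: a; b; c; d]; [:: e; f; g; h];
                [:: i; j; k; l]; [:: m; n; o; p]])) ->
  forall X, T X.
Proof. by move=> hT X; rewrite (mx4_eta X); apply: hT. Qed.

Lemma mx4_inj {F : fieldType} (a b c d e f g h i j k l m n o p
    a' b' c' d' e' f' g' h' i' j' k' l' m' n' o' p' : F) :
  mx4 [:: [:: a; b; c; d]; [:: e; f; g; h];
          [:: i; j; k; l]; [:: m; n; o; p]] =
  mx4 [:: [:: a'; b'; c'; d']; [:: e'; f'; g'; h'];
          [:: i'; j'; k'; l']; [:: m'; n'; o'; p']] ->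
  [/\ [/\ a = a', b = b', c = c' & d = d'],
      [/\ e = e', f = f', g = g' & h = h'],
      [/\ i = i', j = j', k = k' & l = l'] &
      [/\ m = m', n = n', o = o' & p = p']].
Proof.
move=> /matrixP E.
have entry (r s : nat) (hr : (r < 4)%N) (hs : (s < 4)%N) :
    nth 0 (nth [::] [:: [:: a; b; c; d]; [:: e; f; g; h];
                        [:: i; j; k; l]; [:: m; n; o; p]] r) s =
    nth 0 (nth [::] [:: [:: a'; b'; c'; d']; [:: e'; f'; g'; h'];
                        [:: i'; j'; k'; l']; [:: m'; n'; o'; p']] r) s.
  by have := E (Ordinal hr) (Ordinal hs); rewrite !mxE.
split; split; [exact: (entry 0 0)%N | exact: (entry 0 1)%N
 | exact: (entry 0 2)%N | exact: (entry 0 3)%N | exact: (entry 1 0)%N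
 | exact: (entry 1 1)%N | exact: (entry 1 2)%N | exact: (entry 1 3)%N
 | exact: (entry 2 0)%N | exact: (entry 2 1)%N | exact: (entry 2 2)%N
 | exact: (entry 2 3)%N | exact: (entry 3 0)%N | exact: (entry 3 1)%N
 | exact: (entry 3 2)%N | exact: (entry 3 3)%N].
Qed.

Lemma mulmx_mx4 {F : fieldType} (a b c d e f g h i j k l m n o p
    a' b' c' d' e' f' g' h' i' j' k' l' m' n' o' p' : F) :
  mx4 [:: [:: a; b; c; d]; [:: e; f; g; h];
          [:: i; j; k; l]; [:: m; n; o; p]] *m
  mx4 [:: [:: a'; b'; c'; d']; [:: e'; f'; g'; h'];
          [:: i'; j'; k'; l']; [:: m'; n'; o'; p']] =
  mx4 [:: [:: a * a' + b * e' + c * i' + d * m';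
              a * b' + b * f' + c * j' + d * n';
              a * c' + b * g' + c * k' + d * o';
              a * d' + b * h' + c * l' + d * p'];
          [:: e * a' + f * e' + g * i' + h * m';
              e * b' + f * f' + g * j' + h * n';
              e * c' + f * g' + g * k' + h * o';
              e * d' + f * h' + g * l' + h * p'];
          [:: i * a' + j * e' + k * i' + l * m';
              i * b' + j * f' + k * j' + l * n';
              i * c' + j * g' + k * k' + l * o';
              i * d' + j * h' + k * l' + l * p'];
          [:: m * a' + n * e' + o * i' + p * m';
              m * b' + n * f' + o * j' + p * n';
              m * c' + n * g' + o * k' + p * o';
              m * d' + n * h' + o * l' + p * p']].
Proof.
apply/matrixP => -[r hr] [s hs]; rewrite !mxE !big_ord_recr big_ord0 /= !mxE /=.
rewrite add0r.
by case: r hr => [|[|[|[|//]]]] hr; case: s hs => [|[|[|[|//]]]] hs.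
Qed.

Lemma scalar_mx4 {F : fieldType} (a : F) :
  a%:M = mx4 [:: [:: a; 0; 0; 0]; [:: 0; a; 0; 0];
                 [:: 0; 0; a; 0]; [:: 0; 0; 0; a]].
Proof.
apply/matrixP => -[r hr] [s hs]; rewrite !mxE.
by case: r hr => [|[|[|[|//]]]] hr; case: s hs => [|[|[|[|//]]]] hs.
Qed.

Lemma zero_mx4 {F : fieldType} :
  0 = mx4 [:: [:: 0; 0; 0; 0]; [:: 0; 0; 0; 0];
              [:: 0; 0; 0; 0]; [:: 0; 0; 0; 0]] :> 'M[F]_4.
Proof. by rewrite -scalar_mx4 raddf0. Qed.

Ltac mx4_congr :=
  rewrite ?mulmx_mx4;
  congr (mx4 [:: [:: _; _; _; _]; [:: _; _; _; _];
                 [:: _; _; _; _]; [:: _; _; _; _]]).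

Ltac mx4_ring := mx4_congr; ring.

Definition simpmx {F : fieldType} :=
  (@mul0r F, @mulr0 F, @mul1r F, @mulr1 F, @add0r F, @addr0 F).

(** Scaling an inverse by [k] keeps the entries of the explicit inverses below
    polynomial, hence accessible to [ring]. *)
Lemma unitmx_scalar_product {F : fieldType} {n : nat} (X Y : 'M[F]_n) (k : F) :
  k != 0 -> X *m Y = k%:M -> X \in unitmx.
Proof.
move=> k0 XY; suff /mulmx1_unit[] : X *m (k^-1 *: Y) = 1%:M by [].
by rewrite -scalemxAr XY scale_scalar_mx mulVf.
Qed.

Lemma unitmx_mx4 {F : fieldType} (X Y : 'M[F]_4) :
  X *m Y = mx4 [:: [:: 1; 0; 0; 0]; [:: 0; 1; 0; 0];
                   [:: 0; 0; 1; 0]; [:: 0; 0; 0; 1]] -> X \in unitmx.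
Proof. by rewrite -scalar_mx4 => /mulmx1_unit[]. Qed.

Lemma pair_similar_mx4 {F : fieldType} (k : F) (X Y : 'M[F]_4)
    (P Q : mxpair F 4) :
  k != 0 ->
  X *m Y = mx4 [:: [:: k; 0; 0; 0]; [:: 0; k; 0; 0];
                   [:: 0; 0; k; 0]; [:: 0; 0; 0; k]] ->
  P.1 *m X = X *m Q.1 -> P.2 *m X = X *m Q.2 -> pair_similar P Q.
Proof.
rewrite -scalar_mx4 => k0 XY; apply: pair_similar_intro.
exact: unitmx_scalar_product k0 XY.
Qed.

Lemma decomposable_31 {F : fieldType} (P : mxpair F 4)
    (a b c d e f g h i p a' b' c' d' e' f' g' h' i' p' : F) :
  pair_similar P
    (mx4 [:: [:: a; b; c; 0]; [:: d; e; f; 0];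
             [:: g; h; i; 0]; [:: 0; 0; 0; p]],
     mx4 [:: [:: a'; b'; c'; 0]; [:: d'; e'; f'; 0];
             [:: g'; h'; i'; 0]; [:: 0; 0; 0; p']]) ->
  decomposable_pair P.
Proof.
move=> PQ; apply: (block_diagonal_decomposable 3 1 _ _ isT isT PQ);
  apply/matrixP=> -[r hr] [s hs]; rewrite !mxE /=;
  by case: r hr => [|[|[|//]]] hr; case: s hs => [|[|[|//]]] hs.
Qed.

Lemma decomposable_22 {F : fieldType} (P : mxpair F 4)
    (a b c d e f g h a' b' c' d' e' f' g' h' : F) :
  pair_similar P
    (mx4 [:: [:: a; b; 0; 0]; [:: c; d; 0; 0];
             [:: 0; 0; e; f]; [:: 0; 0; g; h]],
     mx4 [:: [:: a'; b'; 0; 0]; [:: c'; d'; 0; 0];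
             [:: 0; 0; e'; f']; [:: 0; 0; g'; h']]) ->
  decomposable_pair P.
Proof.
move=> PQ; apply: (block_diagonal_decomposable 2 2 _ _ isT isT PQ);
  apply/matrixP=> -[r hr] [s hs]; rewrite !mxE /=;
  by case: r hr => [|[|//]] hr; case: s hs => [|[|//]] hs.
Qed.

(** * Jordan forms *)

(** The Jordan form in size two, written with scalars because it is applied to
    two by two blocks scattered in larger matrices. The eigenvector of [l] and
    the second basis vector can be read off the entries of the matrix shifted
    by [l]; which of them is nonzero decides between the explicit choices. *)
Lemma jordan2 {F : closedFieldType} (a b c d : F) :
  exists x y z w l m e : F,
    [/\ x * w - y * z != 0,
        a * x + b * z = l * x /\ c * x + d * z = l * z,
        a * y + b * w = e * x + m * y /\ c * y + d * w = e * z + m * w &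
        e = 0 \/ (e = 1 /\ m = l)].
Proof.
have [l root_l] : exists l : F, b * c = (a - l) * (d - l).
  have [l] := solve_monicpoly (fun i => if i is 0 then b * c - a * d else a + d)
                (isT : (0 < 2)%N).
  rewrite !big_ord_recr big_ord0 /= expr0 expr1 => hl.
  by exists l; ring: hl.
(* The matrix shifted by its eigenvalue l is singular with entries p b c q. *)
have [p ap] : exists p, a = p + l by exists (a - l); ring.
have [q dq] : exists q, d = q + l by exists (d - l); ring.
have {root_l} bc : b * c = p * q by rewrite root_l ap dq; ring.
rewrite {}ap {}dq.
have [qp|tr_neq0] := eqVneq q (- p); last first.
  (* Two distinct eigenvalues: the kernel of the shifted matrix is spanned by
     (q, -c) or (b, -p), and its image, spanned by (b, q) or (p, c), is the
     other eigenspace. *)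
  have {}tr_neq0 : p + q != 0 by rewrite addrC addr_eq0.
  have [p0|p_neq0] := eqVneq p 0.
    exists q, b, (- c), q, l, (p + q + l), 0.
    split; [|by split; ring: bc|by split; ring: bc|by left].
    have -> : q * q - b * - c = (p + q) * (p + q) by ring: bc p0.
    by rewrite mulf_neq0.
  exists b, p, (- p), c, l, (p + q + l), 0.
  split; [|by split; ring: bc|by split; ring: bc|by left].
  have -> : b * c - p * - p = p * (p + q) by ring: bc.
  by rewrite mulf_neq0.
(* The shifted matrix now squares to zero: if it is not zero itself, any vector
   outside its kernel, preceded by its image, is a Jordan chain. *)
rewrite {}qp in bc *.
have [c0|c_neq0] := eqVneq c 0; last first.
  exists p, 1, c, 0, l, l, 1.
  split; [|by split; ring: bc|by split; ring: bc|by right].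
  by rewrite mulr0 sub0r mul1r oppr_eq0.
have [b0|b_neq0] := eqVneq b 0; last first.
  exists b, 0, (- p), 1, l, l, 1.
  split; [|by split; ring: bc|by split; ring: bc|by right].
  by rewrite mulr1 mul0r subr0.
have -> : p = 0.
  have : p * p = 0 by apply: oppr_inj; rewrite -mulrN -bc c0 mulr0 oppr0.
  by move/eqP; rewrite mulf_eq0 orbb => /eqP.
exists 1, 0, 0, 1, l, l, 0; rewrite b0 c0.
split; [|by split; ring|by split; ring|by left].
by rewrite mulr1 mul0r subr0 oner_neq0.
Qed.

(** Rescaling the basis by a square root of the inverse determinant makes the
    determinant one. The inverse of the base change is then its adjugate, and
    the given matrix is a polynomial in the new parameters: after substitution,
    every identity about it follows from the single monomial relation [x * w =
    1 + y * z]. *)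
Lemma jordan2_SL {F : closedFieldType} (a b c d : F) :
  exists x y z w l m e : F,
    [/\ x * w = 1 + y * z,
        a = x * l * w - (x * e + y * m) * z /\
        b = (x * e + y * m) * x - x * l * y,
        c = z * l * w - (z * e + w * m) * z /\
        d = (z * e + w * m) * x - z * l * y &
        e = 0 \/ (e = 1 /\ m = l)].
Proof.
have [x [y [z [w [l [m [e [det0 [e1 e2] [e3 e4] hem]]]]]]]] := jordan2 a b c d.
have [s] := solve_monicpoly
  (fun i => if i is 0 then (x * w - y * z)^-1 else 0) (isT : (0 < 2)%N).
rewrite !big_ord_recr big_ord0 /= add0r mul0r addr0 expr0 mulr1 => s2.
have sdet : s ^+ 2 * (x * w - y * z) = 1 by rewrite s2 mulVf.
have det1 t : t = t * (s ^+ 2 * (x * w - y * z)) by rewrite sdet mulr1.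
exists (s * x), (s * y), (s * z), (s * w), l, m, e; split=> //.
- by rewrite [1]det1; ring.
- split; rewrite [LHS]det1.
    transitivity (s ^+ 2 * (w * (a * x + b * z) - z * (a * y + b * w))).
      by ring.
    by rewrite e1 e3; ring.
  transitivity (s ^+ 2 * (x * (a * y + b * w) - y * (a * x + b * z))).
    by ring.
  by rewrite e1 e3; ring.
- split; rewrite [LHS]det1.
    transitivity (s ^+ 2 * (w * (c * x + d * z) - z * (c * y + d * w))).
      by ring.
    by rewrite e2 e4; ring.
  transitivity (s ^+ 2 * (x * (c * y + d * w) - y * (c * x + d * z))).
    by ring.
  by rewrite e2 e4; ring.
Qed.

(** The vectors [v], [v *m N], ..., [v *m N ^+ k] are linearly independent as
    soon as the last one is the last nonzero iterate: in a linear relation,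
    apply [N ^+ (k - j)], where [j] is the first index with a nonzero
    coefficient; only the term [j] survives. Hence they are the first rows of
    an invertible matrix. *)
Lemma krylov_completion {F : fieldType} {n : nat} (N : 'M[F]_n) (v : 'rV[F]_n)
    (k : nat) :
  (k < n)%N -> v *m N ^+ k != 0 -> v *m N ^+ k.+1 = 0 ->
  exists2 Y : 'M[F]_n, Y \in unitmx &
    forall i : 'I_n, (i <= k)%N -> row i Y = v *m N ^+ i.
Proof.
move=> ltkn vNk vNk1.
pose U : 'M[F]_(k.+1, n) := pid_mx k.+1.
pose K : 'M[F]_n := \matrix_i (v *m N ^+ i).
have vN0 i : (k < i)%N -> v *m N ^+ i = 0.
  by move=> lt; rewrite -(subnKC lt) exprD mulmxA vNk1 mul0mx.
have rowU (M : 'M[F]_n) (i : 'I_k.+1) (i' : 'I_n) :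
    i = i' :> nat -> row i (U *m M) = row i' M.
  move=> ii'; apply/rowP=> j; rewrite !mxE (bigD1 i') //= big1 ?addr0.
    by rewrite mxE ii' eqxx -ii' ltn_ord mul1r.
  move=> s si; rewrite mxE ii' [_ == _](_ : _ = false) ?mul0r //.
  by apply: contraNF si => /eqP e; apply/eqP/val_inj.
have UK_free : row_free (U *m K).
  apply: inj_row_free => u uUK.
  have eq_sum : \sum_(i < k.+1) u 0 i *: (v *m N ^+ i) = 0.
    rewrite -[RHS]uUK mulmx_sum_row; apply: eq_bigr => i _.
    by rewrite (rowU K i (widen_ord ltkn i)) ?rowK.
  suff u0 j (hj : (j < k.+1)%N) : u 0 (Ordinal hj) = 0.
    by apply/rowP=> -[j hj]; rewrite mxE u0.
  elim/ltn_ind: j hj => j IHj hj.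
  have := congr1 (mulmx^~ (N ^+ (k - j))) eq_sum.
  rewrite mul0mx mulmx_suml (bigD1 (Ordinal hj)) //= big1 => [|i ij].
    rewrite addr0 -scalemxAl -mulmxA -[_ *m N ^+ _]exprD subnKC //.
    by move/eqP; rewrite scaler_eq0 (negPf vNk) orbF => /eqP.
  have [lt_ij|le_ji] := ltnP i j.
    case: i lt_ij {ij} => i hi /= lt_ij.
    by rewrite (IHj i lt_ij hi) scale0r mul0mx.
  have lt_ji : (j < i)%N by rewrite ltn_neqAle le_ji andbT eq_sym.
  rewrite -scalemxAl -mulmxA -[_ *m N ^+ _]exprD vN0 ?scaler0 //.
  by rewrite -[k in (k < _)%N](subnKC (_ : j <= k)%N) // ltn_add2r.
have rkU : \rank (U *m K) = \rank U.
  by rewrite (eqP UK_free) rank_pid_mx.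
have [Y uY UKY] := complete_unitmx rkU.
exists Y => // i le_ik.
have e : Ordinal (le_ik : (i < k.+1)%N) = i :> nat by [].
by rewrite -(rowU Y _ _ e) -UKY (rowU _ _ _ e) rowK.
Qed.

(** Acting on row vectors, in a basis that starts with a longest chain of
    iterates, [N] moves each vector of the chain to the next one and kills the
    last one. *)
Lemma krylov_coordinates {F : fieldType} {n : nat} (N : 'M[F]_n) (k : nat) :
  (k < n)%N -> N ^+ k != 0 -> N ^+ k.+1 = 0 ->
  exists X M : 'M[F]_n, [/\ X \in unitmx, N *m X = X *m M &
    forall i j : 'I_n, (i <= k)%N ->
      M i j = ((i < k)%N && (j == i.+1 :> nat))%:R].
Proof.
move=> ltkn Nk Nk1.
have [r rNk] : exists r, row r (N ^+ k) != 0.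
  apply/existsP; apply: contraR Nk => /existsPn h.
  apply/eqP/row_matrixP => i; rewrite row0; apply/eqP.
  by rewrite -[_ == _]negbK.
rewrite rowE in rNk.
have rNk1 : delta_mx 0 r *m N ^+ k.+1 = 0 :> 'rV_n by rewrite Nk1 mulmx0.
have [Y uY rowY] := krylov_completion N _ k ltkn rNk rNk1.
exists (invmx Y), (Y *m N *m invmx Y).
split; [by rewrite unitmx_inv | by rewrite -mulmxA mulKmx |].
move=> i j le_ik; have step : row i Y *m N = delta_mx 0 r *m N ^+ i.+1.
  by rewrite rowY // -mulmxA exprSr.
have -> : (Y *m N *m invmx Y) i j = (row i Y *m N *m invmx Y) 0 j.
  by rewrite -!row_mul [RHS]mxE.
rewrite step; have [lt_ik|le_ki] := ltnP i k; last first.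
  by rewrite (_ : i.+1 = k.+1) ?Nk1 ?mulmx0 ?mul0mx ?mxE //;
    congr _.+1; apply/eqP; rewrite eqn_leq le_ik.
have lt_i1n := leq_ltn_trans lt_ik ltkn.
rewrite -(rowY (Ordinal lt_i1n)) // -row_mul mulmxV // !mxE.
by rewrite eq_sym.
Qed.

Definition supdiag {F : fieldType} (a b c : F) : 'M[F]_4 :=
  mx4 [:: [:: 0; a; 0; 0]; [:: 0; 0; b; 0]; [:: 0; 0; 0; c]; [:: 0; 0; 0; 0]].

(** The nilpotent Jordan forms, numbered by increasing rank and, for equal
    rank, increasing nilpotency index, that is, from the smallest nilpotent
    orbit to the largest. *)
Definition jordan4 (F : fieldType) (k : nat) : 'M[F]_4 :=
  nth 0 [:: supdiag 0 0 0; supdiag 1 0 0; supdiag 1 0 1;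
            supdiag 1 1 0; supdiag 1 1 1] k.

(** Acting on row vectors, [M] has a first Jordan chain of length two, and the
    action on the quotient by this chain is triangular; as [M] squares to zero,
    so do [l] and [m]. If [e = 0], the two remaining vectors are corrected into
    the kernel; if [e = 1], the third vector starts a second chain. *)
Lemma square_zero_jordan4 {F : fieldType} (a b c d l m e : F) :
  let M := mx4 [:: [:: 0; 1; 0; 0]; [:: 0; 0; 0; 0];
                   [:: a; b; l; e]; [:: c; d; 0; m]] in
  e = 0 \/ (e = 1 /\ m = l) -> M *m M = 0 ->
  exists (X : 'M[F]_4) (k : nat),
    [/\ X \in unitmx, (k < 5)%N & M *m X = X *m jordan4 F k].
Proof.
move=> M he; rewrite /M zero_mx4 mulmx_mx4 !simpmx.
have sq0 t : t * t = 0 -> t = 0 :> F by move/eqP; rewrite mulf_eq0 orbb => /eqP.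
case/mx4_inj=> _ _ [+ + /sq0 l0 _] [+ + _ /sq0 m0].
rewrite {}l0 {}m0 {M} !simpmx.
case: he => [->|[-> _]]; rewrite !simpmx.
  move=> _ a0 _ c0; exists (mx4 [:: [:: 1; 0; 0; 0]; [:: 0; 1; 0; 0];
                                    [:: b; 0; 1; 0]; [:: d; 0; 0; 1]]), 1%N.
  split=> //.
    apply: (@unitmx_mx4 _ _
      (mx4 [:: [:: 1; 0; 0; 0]; [:: 0; 1; 0; 0];
               [:: - b; 0; 1; 0]; [:: - d; 0; 0; 1]])).
    by mx4_ring.
  by rewrite a0 c0 /jordan4 /= /supdiag; mx4_ring.
move=> c0 ad _ _; exists (mx4 [:: [:: 1; 0; 0; 0]; [:: 0; 1; 0; 0];
                                  [:: 0; 0; 1; 0]; [:: - a; - b; 0; 1]]), 2%N.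
split=> //.
  apply: (@unitmx_mx4 _ _
    (mx4 [:: [:: 1; 0; 0; 0]; [:: 0; 1; 0; 0];
             [:: 0; 0; 1; 0]; [:: a; b; 0; 1]])).
  by mx4_ring.
have -> : d = - a by apply/eqP; rewrite -addr_eq0 addrC ad.
by rewrite c0 /jordan4 /= /supdiag; mx4_ring.
Qed.

(** The highest nonzero power of [N] gives a longest chain of iterates; the few
    coordinates that the chain leaves undetermined are normalized by hand. *)
Lemma nilpotent_jordan4 {F : closedFieldType} (N : 'M[F]_4) :
  N ^+ 4 = 0 ->
  exists (X : 'M[F]_4) (k : nat),
    [/\ X \in unitmx, (k < 5)%N & N *m X = X *m jordan4 F k].
Proof.
have reduce (M X : 'M[F]_4) : X \in unitmx -> N *m X = X *m M ->
    (exists (Y : 'M[F]_4) (k : nat),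
      [/\ Y \in unitmx, (k < 5)%N & M *m Y = Y *m jordan4 F k]) ->
    exists (Y : 'M[F]_4) (k : nat),
      [/\ Y \in unitmx, (k < 5)%N & N *m Y = Y *m jordan4 F k].
  move=> uX NX [Y [k [uY k5 MY]]]; exists (X *m Y), k.
  by rewrite unitmx_mul uX uY mulmxA NX -!mulmxA MY.
have nil (M X : 'M[F]_4) k :
    X \in unitmx -> N *m X = X *m M -> N ^+ k = 0 -> M ^+ k = 0.
  move=> uX NX Nk; rewrite -[LHS](mulKmx uX) -(intertwine_exp k NX) Nk.
  by rewrite mul0mx mulmx0.
move=> N4; have [N3|N3] := eqVneq (N ^+ 3) 0; last first.
  have [X [M [uX NX rowsM]]] := krylov_coordinates N 3 isT N3 N4.
  apply: (reduce _ _ uX NX); exists 1%:M, 4%N; split=> //.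
    exact: unitmx1.
  by rewrite mul1mx mulmx1 [LHS]mx4_eta /mkseq /= !rowsM ?inordK.
have [N2|N2] := eqVneq (N ^+ 2) 0; last first.
  have [X [M [uX NX rowsM]]] := krylov_coordinates N 2 isT N2 N3.
  apply: (reduce _ _ uX NX).
  have M3 : M *m (M *m M) = 0 := nil _ _ _ uX NX N3.
  move: M3; rewrite (mx4_eta M) /mkseq /=.
  have [r0 r1 r2] : [/\ forall j, M (inord 0) j = (j == 1 :> nat)%:R,
      forall j, M (inord 1) j = (j == 2 :> nat)%:R &
      forall j, M (inord 2) j = 0].
    by split=> j; rewrite rowsM !inordK.
  rewrite !(r0, r1, r2) !inordK //=.
  move: (M _ _) (M _ _) (M _ _) (M _ _) => d c b a.
  rewrite zero_mx4 !mulmx_mx4 !simpmx => /mx4_inj[_ _ _ [_ _ + d3]].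
  have -> : d = 0 by apply/eqP; move/eqP: d3; rewrite !mulf_eq0 !orbb.
  rewrite !simpmx => a0.
  (* Subtracting b times the first and c times the second vector of the chain
     from the last basis vector puts it in the kernel. *)
  exists (mx4 [:: [:: 1; 0; 0; 0]; [:: 0; 1; 0; 0];
                  [:: 0; 0; 1; 0]; [:: b; c; 0; 1]]), 3%N; split=> //.
    apply: (@unitmx_mx4 _ _
      (mx4 [:: [:: 1; 0; 0; 0]; [:: 0; 1; 0; 0];
               [:: 0; 0; 1; 0]; [:: - b; - c; 0; 1]])).
    by mx4_ring.
  by rewrite a0 /jordan4 /= /supdiag; mx4_ring.
have [N1|N1] := eqVneq (N ^+ 1) 0; last first.
  have [X [M [uX NX rowsM]]] := krylov_coordinates N 1 isT N1 N2.
  apply: (reduce _ _ uX NX).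
  have M2 : M *m M = 0 := nil _ _ _ uX NX N2.
  move: M2; rewrite (mx4_eta M) /mkseq /=.
  have [r0 r1] : (forall j, M (inord 0) j = (j == 1 :> nat)%:R :> F) /\
      forall j, M (inord 1) j = 0.
    by split=> j; rewrite rowsM !inordK.
  rewrite !(r0, r1) !inordK //=.
  move: (M _ _) (M _ _) (M _ _) (M _ _) (M _ _) (M _ _) (M _ _) (M _ _).
  move=> d2 d1 v b c2 c1 u a.
  have [x [y [z [w [l [m [e [det1 [-> ->] [-> ->] he]]]]]]]] :=
    jordan2_SL c1 c2 d1 d2.
  (* Give the action on the quotient by the chain its Jordan form. *)
  set M1 := mx4 _ => M2.
  pose P := mx4 [:: [:: 1; 0; 0; 0]; [:: 0; 1; 0; 0];
                    [:: 0; 0; x; y]; [:: 0; 0; z; w]].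
  pose M1' := mx4 [:: [:: 0; 1; 0; 0]; [:: 0; 0; 0; 0];
                      [:: w * a - y * b; w * u - y * v; l; e];
                      [:: x * b - z * a; x * v - z * u; 0; m]].
  have uP : P \in unitmx.
    apply: (@unitmx_mx4 _ _
      (mx4 [:: [:: 1; 0; 0; 0]; [:: 0; 1; 0; 0];
               [:: 0; 0; w; - y]; [:: 0; 0; - z; x]])).
    by rewrite /P; mx4_congr; ring: det1.
  have M1P : M1 *m P = P *m M1'.
    by rewrite /M1 /M1' /P; mx4_congr; ring: det1.
  have M2' : M1' *m M1' = 0.
    rewrite -[LHS](mulKmx uP) -[M1' *m M1']/(M1' ^+ 2).
    by rewrite -(intertwine_exp 2 M1P) [M1 ^+ 2]M2 mul0mx mulmx0.
  have [Y [k [uY k5 MY]]] := square_zero_jordan4 _ _ _ _ _ _ _ he M2'.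
  exists (P *m Y), k; split=> //; first by rewrite unitmx_mul uP.
  by rewrite mulmxA M1P -!mulmxA MY.
exists 1%:M, 0%N; split=> //; first exact: unitmx1.
by rewrite -[N]expr1 N1 mul0mx mul1mx /jordan4 /= /supdiag zero_mx4.
Qed.

(** * Centralizers of the Jordan forms *)

Lemma centralizer_jordan4_4 {F : fieldType} (X : 'M[F]_4) :
  jordan4 F 4 *m X = X *m jordan4 F 4 ->
  exists a b c d, X = mx4 [:: [:: a; b; c; d]; [:: 0; a; b; c];
                              [:: 0; 0; a; b]; [:: 0; 0; 0; a]].
Proof.
move: X; apply: mx4_ind => ? ? ? ? ? ? ? ? ? ? ? ? ? ? ? ?.
rewrite /jordan4 /= /supdiag !mulmx_mx4 !simpmx.
case/mx4_inj=> -[? ? ? ?] [? ? ? ?] [? ? ? ?] [? ? ? ?]; subst.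
by do 4 eexists.
Qed.

Lemma centralizer_jordan4_3 {F : fieldType} (X : 'M[F]_4) :
  jordan4 F 3 *m X = X *m jordan4 F 3 ->
  exists a b c d e f, X = mx4 [:: [:: a; b; c; d]; [:: 0; a; b; 0];
                                  [:: 0; 0; a; 0]; [:: 0; 0; e; f]].
Proof.
move: X; apply: mx4_ind => ? ? ? ? ? ? ? ? ? ? ? ? ? ? ? ?.
rewrite /jordan4 /= /supdiag !mulmx_mx4 !simpmx.
case/mx4_inj=> -[? ? ? ?] [? ? ? ?] [? ? ? ?] [? ? ? ?]; subst.
by do 6 eexists.
Qed.

Lemma centralizer_jordan4_2 {F : fieldType} (X : 'M[F]_4) :
  jordan4 F 2 *m X = X *m jordan4 F 2 ->
  exists p1 p2 p3 p4 q1 q2 q3 q4,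
    X = mx4 [:: [:: p1; q1; p2; q2]; [:: 0; p1; 0; p2];
                [:: p3; q3; p4; q4]; [:: 0; p3; 0; p4]].
Proof.
move: X; apply: mx4_ind => ? ? ? ? ? ? ? ? ? ? ? ? ? ? ? ?.
rewrite /jordan4 /= /supdiag !mulmx_mx4 !simpmx.
case/mx4_inj=> -[? ? ? ?] [? ? ? ?] [? ? ? ?] [? ? ? ?]; subst.
by do 8 eexists.
Qed.

Lemma centralizer_jordan4_1 {F : fieldType} (X : 'M[F]_4) :
  jordan4 F 1 *m X = X *m jordan4 F 1 ->
  exists a b u1 u2 v1 v2 d1 d2 d3 d4,
    X = mx4 [:: [:: a; b; u1; u2]; [:: 0; a; 0; 0];
                [:: 0; v1; d1; d2]; [:: 0; v2; d3; d4]].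
Proof.
move: X; apply: mx4_ind => ? ? ? ? ? ? ? ? ? ? ? ? ? ? ? ?.
rewrite /jordan4 /= /supdiag !mulmx_mx4 !simpmx.
case/mx4_inj=> -[? ? ? ?] [? ? ? ?] [? ? ? ?] [? ? ? ?]; subst.
by do 10 eexists.
Qed.

(** * Existence of a canonical form *)

Definition classified {F : fieldType} (P : mxpair F 4) : Prop :=
  decomposable_pair P \/ exists Q, canonical_pair Q /\ pair_similar P Q.

Lemma classified_similar {F : fieldType} {P Q : mxpair F 4} :
  pair_similar P Q -> classified Q -> classified P.
Proof.
move=> PQ [[n1 [n2 [e [A1 [B1 [A2 [B2 [h1 h2 hQ]]]]]]]]|[R [cR QR]]].
  left; exists n1, n2, e, A1, B1, A2, B2; split=> //.
  exact: pair_similar_trans PQ hQ.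
by right; exists R; split=> //; apply: pair_similar_trans PQ QR.
Qed.

Lemma fourth_power_eq0 {F : fieldType} (x : F) : x * (x * (x * x)) = 0 -> x = 0.
Proof. by move/eqP; rewrite !mulf_eq0 !orbb => /eqP. Qed.

Lemma classified_jordan4_4 {F : fieldType} (B : 'M[F]_4) :
  commuting_nilpotent_pair (jordan4 F 4, B) -> classified (jordan4 F 4, B).
Proof.
case=> /= _ B4 /centralizer_jordan4_4[a [b [c [d eB]]]].
have {}B4 : B *m (B *m (B *m B)) = 0 := B4.
move: B4; rewrite eB zero_mx4 !mulmx_mx4 !simpmx.
case/mx4_inj=> -[/fourth_power_eq0-> _ _ _] _ _ _.
by right; eexists; split; [apply: form_1_1 | apply: pair_similar_refl].
Qed.

Lemma classified_jordan4_3 {F : fieldType} (B : 'M[F]_4) :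
  commuting_nilpotent_pair (jordan4 F 3, B) -> classified (jordan4 F 3, B).
Proof.
case=> /= _ B4 /centralizer_jordan4_3[a [b [c [d [e [f eB]]]]]].
have {}B4 : B *m (B *m (B *m B)) = 0 := B4.
move: B4; rewrite eB zero_mx4 !mulmx_mx4 !simpmx.
case/mx4_inj=> -[/fourth_power_eq0-> _ _ _] _ _ [_ _ _ /fourth_power_eq0->].
rewrite /jordan4 /= /supdiag.
have [->|e0] := eqVneq e 0; last first.
  (* Rescaling the last vector by e and adding c times the first one to it
     absorbs e and c; the product d * e does not change. *)
  right; eexists; split; first exact: (form_2_1 b (d * e)).
  apply: (pair_similar_mx4 e
    (mx4 [:: [:: 1; 0; 0; c]; [:: 0; 1; 0; 0];
             [:: 0; 0; 1; 0]; [:: 0; 0; 0; e]])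
    (mx4 [:: [:: e; 0; 0; - c]; [:: 0; e; 0; 0];
             [:: 0; 0; e; 0]; [:: 0; 0; 0; 1]])) => //=; mx4_ring.
have [->|d0] := eqVneq d 0; last first.
  (* Now c is cleared by adding to the third vector a multiple of the last
     one, and d by a relative rescaling. *)
  right; eexists; split; first exact: (form_2_2 b).
  apply: (pair_similar_mx4 d
    (mx4 [:: [:: d; 0; 0; 0]; [:: 0; d; 0; 0];
             [:: 0; 0; d; 0]; [:: 0; 0; - c; 1]])
    (mx4 [:: [:: 1; 0; 0; 0]; [:: 0; 1; 0; 0];
             [:: 0; 0; 1; 0]; [:: 0; 0; c; d]])) => //=; mx4_ring.
by left; apply: decomposable_31 (pair_similar_refl _).
Qed.

(** Two blocks of size two make [B] a matrix [p + q t] of size two over the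
    dual numbers [F[t]/(t^2)], with [p] already in Jordan form. If [p] is the
    nilpotent block, conjugation by [1 + y t] changes [q] by the commutator of
    [p] and [y], which leaves exactly the trace of [q] and its lower left
    entry. If [p = 0], [q] is defined up to ordinary conjugation. *)
Lemma classified_jordan4_2_triangular {F : closedFieldType}
    (q1 q2 q3 q4 l m e : F) :
  let B := mx4 [:: [:: l; q1; e; q2]; [:: 0; l; 0; e];
                   [:: 0; q3; m; q4]; [:: 0; 0; 0; m]] in
  e = 0 \/ (e = 1 /\ m = l) -> B ^+ 4 = 0 -> classified (jordan4 F 2, B).
Proof.
move=> B he B4; have {}B4 : B *m (B *m (B *m B)) = 0 := B4.
move: B4; rewrite /B zero_mx4 !mulmx_mx4 !simpmx.
case/mx4_inj=> -[/fourth_power_eq0-> _ _ _] _ _ [_ _ _ /fourth_power_eq0->].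
rewrite /jordan4 /= /supdiag.
case: he => [->|[-> _]]; last first.
  (* Conjugation by 1 + y t, where the second row of y is (-q1, -q2). *)
  right; eexists; split; first exact: (form_3_1 q3 (q1 + q4)).
  apply: (pair_similar_mx4 1
    (mx4 [:: [:: 1; 0; 0; 0]; [:: 0; 1; 0; 0];
             [:: 0; - q1; 1; - q2]; [:: 0; 0; 0; 1]])
    (mx4 [:: [:: 1; 0; 0; 0]; [:: 0; 1; 0; 0];
             [:: 0; q1; 1; q2]; [:: 0; 0; 0; 1]]));
    rewrite ?oner_neq0 //=; mx4_ring.
have [x [y [z [w [l' [m' [e' [det1 [-> ->] [-> ->] he']]]]]]]] :=
  jordan2_SL q1 q2 q3 q4.
have sim : pair_similar
  (mx4 [:: [:: 0; 1; 0; 0]; [:: 0; 0; 0; 0];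
           [:: 0; 0; 0; 1]; [:: 0; 0; 0; 0]],
   mx4 [:: [:: 0; x * l' * w - (x * e' + y * m') * z; 0;
               (x * e' + y * m') * x - x * l' * y];
           [:: 0; 0; 0; 0];
           [:: 0; z * l' * w - (z * e' + w * m') * z; 0;
               (z * e' + w * m') * x - z * l' * y];
           [:: 0; 0; 0; 0]])
  (mx4 [:: [:: 0; 1; 0; 0]; [:: 0; 0; 0; 0];
           [:: 0; 0; 0; 1]; [:: 0; 0; 0; 0]],
   mx4 [:: [:: 0; l'; 0; e']; [:: 0; 0; 0; 0];
           [:: 0; 0; 0; m']; [:: 0; 0; 0; 0]]).
  apply: (pair_similar_mx4 1
    (mx4 [:: [:: x; 0; y; 0]; [:: 0; x; 0; y];
             [:: z; 0; w; 0]; [:: 0; z; 0; w]])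
    (mx4 [:: [:: w; 0; - y; 0]; [:: 0; w; 0; - y];
             [:: - z; 0; x; 0]; [:: 0; - z; 0; x]]));
    rewrite ?oner_neq0 //=; mx4_congr; ring: det1.
case: he' sim => [->|[-> ->]] sim; first by left; apply: decomposable_22 sim.
by right; eexists; split; [apply: form_3_2 | apply: sim].
Qed.

Lemma classified_jordan4_2 {F : closedFieldType} (B : 'M[F]_4) :
  commuting_nilpotent_pair (jordan4 F 2, B) -> classified (jordan4 F 2, B).
Proof.
move=> hcn; have [_ _] := hcn.
case/centralizer_jordan4_2=> [p1 [p2 [p3 [p4 [q1 [q2 [q3 [q4 /= eB]]]]]]]].
have [x [y [z [w [l [m [e [det1 [e1 e2] [e3 e4] he]]]]]]]] :=
  jordan2_SL p1 p2 p3 p4.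
set r1 := w * (q1 * x + q2 * z) - y * (q3 * x + q4 * z).
set r2 := w * (q1 * y + q2 * w) - y * (q3 * y + q4 * w).
set r3 := x * (q3 * x + q4 * z) - z * (q1 * x + q2 * z).
set r4 := x * (q3 * y + q4 * w) - z * (q1 * y + q2 * w).
have sim : pair_similar (jordan4 F 2, B)
  (jordan4 F 2, mx4 [:: [:: l; r1; e; r2]; [:: 0; l; 0; e];
                        [:: 0; r3; m; r4]; [:: 0; 0; 0; m]]).
  rewrite eB e1 e2 e3 e4 /jordan4 /= /supdiag /r1 /r2 /r3 /r4.
  apply: (pair_similar_mx4 1
    (mx4 [:: [:: x; 0; y; 0]; [:: 0; x; 0; y];
             [:: z; 0; w; 0]; [:: 0; z; 0; w]])
    (mx4 [:: [:: w; 0; - y; 0]; [:: 0; w; 0; - y];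
             [:: - z; 0; x; 0]; [:: 0; - z; 0; x]]));
    rewrite ?oner_neq0 //=; mx4_congr; ring: det1.
apply: (classified_similar sim).
have [_ B4 _] := commuting_nilpotent_similar sim hcn.
exact: classified_jordan4_2_triangular.
Qed.

(** Here [B] maps the fourth basis vector to the third one, modulo the block of
    size two. When [v2 != 0], the second basis vector generates the whole space
    under the pair, and [u1 * v2] is the only invariant. When [v2 = 0] and [u1
    != 0], the fourth basis vector generates all but one dimension, and the
    second one can be corrected so that [B] kills it. When both vanish, a
    similar correction of the second and third vectors makes the first two
    split off from the others. *)
Lemma classified_jordan4_1_chain {F : fieldType} (b u1 u2 v1 v2 : F) :
  classified (jordan4 F 1, mx4 [:: [:: 0; b; u1; u2]; [:: 0; 0; 0; 0];
                                   [:: 0; v1; 0; 1]; [:: 0; v2; 0; 0]]).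
Proof.
rewrite /jordan4 /= /supdiag.
have [->|v2_neq0] := eqVneq v2 0; last first.
  right; eexists; split; first exact: (form_4_1 (u1 * v2)).
  (* Columns two, four, three are e2, B e2, B (B e2). *)
  apply: (pair_similar_mx4 (v2 * v2)
    (mx4 [:: [:: 1; 0; v1 * u1 + v2 * u2; b]; [:: 0; 1; 0; 0];
             [:: 0; 0; v2; v1]; [:: 0; 0; 0; v2]])
    (mx4 [:: [:: v2 * v2; 0; - (v1 * u1 + v2 * u2) * v2;
                 (v1 * u1 + v2 * u2) * v1 - b * v2];
             [:: 0; v2 * v2; 0; 0];
             [:: 0; 0; v2; - v1]; [:: 0; 0; 0; v2]]));
    rewrite ?mulf_neq0 //=; mx4_ring.
have [->|u1_neq0] := eqVneq u1 0; last first.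
  right; eexists; split; first exact: form_4_2.
  (* Columns four and three are e4 and B e4; column two is u1 e2 corrected by
     e3 and e4 so that B kills it. *)
  apply: (pair_similar_mx4 (u1 * u1)
    (mx4 [:: [:: u1; 0; u2; 0]; [:: 0; u1; 0; 0];
             [:: 0; v1 * u2 - b; 1; 0]; [:: 0; - u1 * v1; 0; 1]])
    (mx4 [:: [:: u1; u2 * (v1 * u2 - b); - u1 * u2; 0]; [:: 0; u1; 0; 0];
             [:: 0; - (v1 * u2 - b) * u1; u1 * u1; 0];
             [:: 0; u1 * v1 * u1; 0; u1 * u1]]));
    rewrite ?mulf_neq0 //=; mx4_ring.
left; apply: (@decomposable_22 _ _ 0 1 0 0 0 0 0 0
                               0 (b - v1 * u2) 0 0 0 1 0 0).
apply: (pair_similar_mx4 1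
  (mx4 [:: [:: 1; 0; u2; 0]; [:: 0; 1; 0; 0];
           [:: 0; 0; 1; 0]; [:: 0; - v1; 0; 1]])
  (mx4 [:: [:: 1; 0; - u2; 0]; [:: 0; 1; 0; 0];
           [:: 0; 0; 1; 0]; [:: 0; v1; 0; 1]]));
  rewrite ?oner_neq0 //=; mx4_ring.
Qed.

(** Here [B] kills the blocks of size one modulo the block of size two: what
    remains, apart from [b], is a row [u] and a column [v], acted upon by the
    linear group of size two, with the invariant [u v]. If [u v != 0], the
    plane of the third and fourth vectors is the sum of the line of [v] and the
    kernel of [u], and the latter splits off; if [u] or [v] is zero, a line
    splits off as well. Otherwise [v] spans the kernel of [u] and the pair is
    canonical. *)
Lemma classified_jordan4_1_flat {F : fieldType} (b u1 u2 v1 v2 : F) :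
  classified (jordan4 F 1, mx4 [:: [:: 0; b; u1; u2]; [:: 0; 0; 0; 0];
                                   [:: 0; v1; 0; 0]; [:: 0; v2; 0; 0]]).
Proof.
rewrite /jordan4 /= /supdiag.
have [uv0|uv_neq0] := eqVneq (u1 * v1 + u2 * v2) 0; last first.
  (* The last two columns are v and a vector spanning the kernel of u. *)
  left; apply: (@decomposable_31 _ _ 0 1 0 0 0 0 0 0 0 0
                                 0 b (u1 * v1 + u2 * v2) 0 0 0 0 1 0 0).
  apply: (pair_similar_mx4 (u1 * v1 + u2 * v2)
    (mx4 [:: [:: 1; 0; 0; 0]; [:: 0; 1; 0; 0];
             [:: 0; 0; v1; u2]; [:: 0; 0; v2; - u1]])
    (mx4 [:: [:: u1 * v1 + u2 * v2; 0; 0; 0];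
             [:: 0; u1 * v1 + u2 * v2; 0; 0];
             [:: 0; 0; u1; u2]; [:: 0; 0; v2; - v1]])) => //=; mx4_ring.
have [u10|u1_neq0] := eqVneq u1 0; last first.
  have [v20|v2_neq0] := eqVneq v2 0; last first.
    have {}uv0 : u1 * v1 = - (u2 * v2) by apply/eqP; rewrite -addr_eq0 uv0.
    right; eexists; split; first exact: form_4_3.
    (* Column three is a vector on which u is nonzero, columns two and four are
       u1 e2 and its image under B. *)
    apply: (pair_similar_mx4 (u1 * v2)
      (mx4 [:: [:: u1; 0; 0; u1 * b]; [:: 0; u1; 0; 0];
               [:: 0; 0; 1; u1 * v1]; [:: 0; 0; 0; u1 * v2]])
      (mx4 [:: [:: v2; 0; 0; - b]; [:: 0; v2; 0; 0];
               [:: 0; 0; u1 * v2; - (u1 * v1)]; [:: 0; 0; 0; 1]]));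
      rewrite ?mulf_neq0 //=; mx4_congr; ring: uv0.
  have v10 : v1 = 0.
    apply/eqP; move/eqP: uv0.
    by rewrite v20 mulr0 addr0 mulf_eq0 (negPf u1_neq0).
  rewrite v10 v20; left; apply: (@decomposable_31 _ _ 0 1 0 0 0 0 0 0 0 0
                                                  0 b u1 0 0 0 0 0 0 0).
  apply: (pair_similar_mx4 u1
    (mx4 [:: [:: 1; 0; 0; 0]; [:: 0; 1; 0; 0];
             [:: 0; 0; 1; u2]; [:: 0; 0; 0; - u1]])
    (mx4 [:: [:: u1; 0; 0; 0]; [:: 0; u1; 0; 0];
             [:: 0; 0; u1; u2]; [:: 0; 0; 0; - 1]])) => //=; mx4_ring.
rewrite u10 mul0r add0r in uv0 *.
have [u20|u2_neq0] := eqVneq u2 0; last first.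
  have -> : v2 = 0.
    by apply/eqP; move/eqP: uv0; rewrite mulf_eq0 (negPf u2_neq0).
  have [->|v1_neq0] := eqVneq v1 0; last first.
    right; eexists; split; first exact: form_4_3.
    apply: (pair_similar_mx4 (u2 * v1)
      (mx4 [:: [:: u2; 0; 0; u2 * b]; [:: 0; u2; 0; 0];
               [:: 0; 0; 0; u2 * v1]; [:: 0; 0; 1; 0]])
      (mx4 [:: [:: v1; 0; - b; 0]; [:: 0; v1; 0; 0];
               [:: 0; 0; 0; u2 * v1]; [:: 0; 0; 1; 0]]));
      rewrite ?mulf_neq0 //=; mx4_ring.
  left; apply: (@decomposable_31 _ _ 0 1 0 0 0 0 0 0 0 0
                                 0 b u2 0 0 0 0 0 0 0).
  apply: (pair_similar_mx4 1
    (mx4 [:: [:: 1; 0; 0; 0]; [:: 0; 1; 0; 0];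
             [:: 0; 0; 0; 1]; [:: 0; 0; 1; 0]])
    (mx4 [:: [:: 1; 0; 0; 0]; [:: 0; 1; 0; 0];
             [:: 0; 0; 0; 1]; [:: 0; 0; 1; 0]]));
    rewrite ?oner_neq0 //=; mx4_ring.
rewrite u20; have [->|v1_neq0] := eqVneq v1 0; last first.
  left; apply: (@decomposable_31 _ _ 0 1 0 0 0 0 0 0 0 0
                                 0 b 0 0 0 0 0 1 0 0).
  apply: (pair_similar_mx4 v1
    (mx4 [:: [:: 1; 0; 0; 0]; [:: 0; 1; 0; 0];
             [:: 0; 0; v1; 0]; [:: 0; 0; v2; 1]])
    (mx4 [:: [:: v1; 0; 0; 0]; [:: 0; v1; 0; 0];
             [:: 0; 0; 1; 0]; [:: 0; 0; - v2; v1]])) => //=; mx4_ring.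
left; apply: (@decomposable_31 _ _ 0 1 0 0 0 0 0 0 0 0
                               0 b 0 0 0 0 0 v2 0 0).
apply: (pair_similar_mx4 1
  (mx4 [:: [:: 1; 0; 0; 0]; [:: 0; 1; 0; 0];
           [:: 0; 0; 0; 1]; [:: 0; 0; 1; 0]])
  (mx4 [:: [:: 1; 0; 0; 0]; [:: 0; 1; 0; 0];
           [:: 0; 0; 0; 1]; [:: 0; 0; 1; 0]]));
  rewrite ?oner_neq0 //=; mx4_ring.
Qed.

Lemma classified_jordan4_1 {F : closedFieldType} (B : 'M[F]_4) :
  commuting_nilpotent_pair (jordan4 F 1, B) -> classified (jordan4 F 1, B).
Proof.
move=> hcn; have [_ _] := hcn.
case/centralizer_jordan4_1=>
  [a [b [u1 [u2 [v1 [v2 [d1 [d2 [d3 [d4 /= eB]]]]]]]]]].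
have [x [y [z [w [l [m [e [det1 [e1 e2] [e3 e4] he]]]]]]]] :=
  jordan2_SL d1 d2 d3 d4.
have sim : pair_similar (jordan4 F 1, B)
  (jordan4 F 1, mx4 [:: [:: a; b; u1 * x + u2 * z; u1 * y + u2 * w];
                        [:: 0; a; 0; 0];
                        [:: 0; w * v1 - y * v2; l; e];
                        [:: 0; x * v2 - z * v1; 0; m]]).
  rewrite eB e1 e2 e3 e4 /jordan4 /= /supdiag.
  apply: (pair_similar_mx4 1
    (mx4 [:: [:: 1; 0; 0; 0]; [:: 0; 1; 0; 0];
             [:: 0; 0; x; y]; [:: 0; 0; z; w]])
    (mx4 [:: [:: 1; 0; 0; 0]; [:: 0; 1; 0; 0];
             [:: 0; 0; w; - y]; [:: 0; 0; - z; x]]));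
    rewrite ?oner_neq0 //=; mx4_congr; ring: det1.
apply: (classified_similar sim).
have [_] := commuting_nilpotent_similar sim hcn.
move: (u1 * x + _) (u1 * y + _) (w * v1 - _) (x * v2 - _) => u1' u2' v1' v2'.
set B' := (_, _).2 => B4 _; have {}B4 : B' *m (B' *m (B' *m B')) = 0 := B4.
move: B4; rewrite /B' zero_mx4 !mulmx_mx4 !simpmx => /mx4_inj.
case=> -[/fourth_power_eq0-> _ _ _] _ [_ _ /fourth_power_eq0-> _].
case=> _ _ _ /fourth_power_eq0->.
case: he => [->|[-> _]]; first exact: classified_jordan4_1_flat.
exact: classified_jordan4_1_chain.
Qed.

(** When the first matrix vanishes, the second one alone decides: it is
    indecomposable exactly when it is a single Jordan block. *)
Lemma classified_jordan4_0 {F : closedFieldType} (B : 'M[F]_4) :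
  commuting_nilpotent_pair (jordan4 F 0, B) -> classified (jordan4 F 0, B).
Proof.
case=> /= _ /nilpotent_jordan4[X [k [uX k5 BX]]] _.
have sim : pair_similar (jordan4 F 0, B) (jordan4 F 0, jordan4 F k).
  apply: (pair_similar_intro _ _ X) => //=.
  by rewrite -[jordan4 F 0]/(supdiag 0 0 0) /supdiag -zero_mx4 mul0mx mulmx0.
apply: (classified_similar sim).
case: k k5 {BX sim} => [|[|[|[|[|//]]]]] _; rewrite /jordan4 /= /supdiag.
- by left; apply: decomposable_31 (pair_similar_refl _).
- by left; apply: decomposable_31 (pair_similar_refl _).
- by left; apply: decomposable_22 (pair_similar_refl _).
- by left; apply: decomposable_31 (pair_similar_refl _).
by right; eexists; split; [apply: form_5_1 | apply: pair_similar_refl].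
Qed.

(** * Uniqueness of the canonical form *)

Lemma unitmx_col0_neq0 {F : fieldType} (b c d f g h j k l n o p : F) :
  mx4 [:: [:: 0; b; c; d]; [:: 0; f; g; h];
          [:: 0; j; k; l]; [:: 0; n; o; p]] \notin unitmx.
Proof.
apply/negP=> uX; have := mulKmx uX (delta_mx ord0 ord0 : 'cV_4).
set X := mx4 _ in uX *; have -> : X *m delta_mx ord0 ord0 = 0 :> 'cV_4.
  apply/colP=> -[i hi]; rewrite -colE !mxE.
  by case: i hi => [|[|[|[|//]]]] hi.
rewrite mulmx0 => /colP/(_ ord0); rewrite !mxE => /eqP.
by rewrite eq_sym oner_eq0.
Qed.

Lemma unitmx_dependent_cols {F : fieldType} (a b c d f h j l n p : F) :
  mx4 [:: [:: a; b; c; d]; [:: 0; f; 0; h];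
          [:: 0; j; 0; l]; [:: 0; n; 0; p]] \notin unitmx.
Proof.
have [->|a0] := eqVneq a 0; first exact: unitmx_col0_neq0.
apply/negP=> uX; set X := mx4 _ in uX.
pose Y := mx4 [:: [:: c; 0; 0; 0]; [:: 0; 0; 0; 0];
                  [:: - a; 0; 0; 0]; [:: 0; 0; 0; 0]].
have XY : X *m Y = 0 by rewrite zero_mx4 /X /Y; mx4_ring.
have := mulKmx uX Y; rewrite XY mulmx0 zero_mx4.
case/mx4_inj=> _ _ [/eqP + _ _ _] _.
by rewrite eq_sym oppr_eq0 (negPf a0).
Qed.

(** Let [J] be the smaller form and [J'] the larger one. Unless they have ranks
    one and two with square zero, some power of [J] vanishes while the same
    power of [J'] has the first basis vector in its image, so [X] kills that
    vector. In the remaining case [J] has rank one, and [X] maps the two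
    dimensional image of [J'] into the image of [J]: the first and third
    columns are proportional. *)
Lemma jordan4_intertwiner {F : fieldType} (k k' : nat) (X : 'M[F]_4) :
  (k < k' < 5)%N -> jordan4 F k *m X = X *m jordan4 F k' -> X \notin unitmx.
Proof.
move=> lt; move: X; apply: mx4_ind => ? ? ? ? ? ? ? ? ? ? ? ? ? ? ? ?.
case: k' lt => [|[|[|[|[|k']]]]]; rewrite ?andbF //;
  case: k => [|[|[|[|k]]]] // _;
  rewrite /jordan4 /= /supdiag !mulmx_mx4 !simpmx;
  case/mx4_inj=> -[? ? ? ?] [? ? ? ?] [? ? ? ?] [? ? ? ?]; subst;
  exact: unitmx_col0_neq0 || exact: unitmx_dependent_cols.
Qed.

(** Sorting the nine families by the Jordan form of their first matrix leaves
    at most three families to compare with one another. *)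
Definition canonical_second {F : fieldType} (k : nat) (C : 'M[F]_4) : Prop :=
  match k with
  | 4 => exists lambda mu nu, C =
           mx4 [:: [:: 0; lambda; mu; nu]; [:: 0; 0; lambda; mu];
                   [:: 0; 0; 0; lambda]; [:: 0; 0; 0; 0]]
  | 3 => (exists lambda mu, C =
           mx4 [:: [:: 0; lambda; 0; mu]; [:: 0; 0; lambda; 0];
                   [:: 0; 0; 0; 0]; [:: 0; 0; 1; 0]]) \/
         (exists lambda, C =
           mx4 [:: [:: 0; lambda; 0; 1]; [:: 0; 0; lambda; 0];
                   [:: 0; 0; 0; 0]; [:: 0; 0; 0; 0]])
  | 2 => (exists lambda mu, C =
           mx4 [:: [:: 0; 0; 1; 0]; [:: 0; 0; 0; 1];
                   [:: 0; lambda; 0; mu]; [:: 0; 0; 0; 0]]) \/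
         (exists lambda, C =
           mx4 [:: [:: 0; lambda; 0; 1]; [:: 0; 0; 0; 0];
                   [:: 0; 0; 0; lambda]; [:: 0; 0; 0; 0]])
  | 1 => [\/ exists lambda, C =
           mx4 [:: [:: 0; 0; lambda; 0]; [:: 0; 0; 0; 0];
                   [:: 0; 0; 0; 1]; [:: 0; 1; 0; 0]],
         C = mx4 [:: [:: 0; 0; 1; 0]; [:: 0; 0; 0; 0];
                     [:: 0; 0; 0; 1]; [:: 0; 0; 0; 0]] |
         C = mx4 [:: [:: 0; 0; 1; 0]; [:: 0; 0; 0; 0];
                     [:: 0; 0; 0; 0]; [:: 0; 1; 0; 0]]]
  (* Only k = 0 matters: the first matrix is then zero. *)
  | _ => C = jordan4 F 4
  end.

Lemma canonical_pair_jordan4 {F : fieldType} (P : mxpair F 4) :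
  canonical_pair P ->
  exists k C, [/\ (k < 5)%N, P = (jordan4 F k, C) & canonical_second k C].
Proof.
case=> [l m n|l m|l|l m|l|l| | | ].
- by exists 4%N; eexists; split=> //; exists l, m, n.
- by exists 3%N; eexists; split=> //; left; exists l, m.
- by exists 3%N; eexists; split=> //; right; exists l.
- by exists 2%N; eexists; split=> //; left; exists l, m.
- by exists 2%N; eexists; split=> //; right; exists l.
- by exists 1%N; eexists; split=> //; constructor 1; exists l.
- by exists 1%N; eexists; split=> //; constructor 2.
- by exists 1%N; eexists; split=> //; constructor 3.
- by exists 0%N; eexists; split.
Qed.

(** The second matrix is a polynomial in the first one, hence commutes with
    every intertwiner [X] between copies of that one. So [X *m C = X *m D], and
    the first rows give the parameters one after the other. *)
Lemma canonical_second_unique_4 {F : fieldType} (C D : 'M[F]_4) :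
  canonical_second 4 C -> canonical_second 4 D ->
  pair_similar (jordan4 F 4, C) (jordan4 F 4, D) -> C = D.
Proof.
case=> l [m [n ->]] [l' [m' [n' ->]]] /pair_similar_elim[X [uX /= hJ]].
have [a [b [c [d eX]]]] := centralizer_jordan4_4 X hJ.
have a_neq0 : a != 0.
  by apply: contraTneq uX => a0; rewrite eX a0 unitmx_col0_neq0.
rewrite eX !mulmx_mx4 !simpmx => /mx4_inj[[_ el em en] _ _ _].
have ll : l = l' by apply: (mulfI a_neq0); rewrite -el mulrC.
have mm : m = m'.
  apply: (mulfI a_neq0); apply: (addrI (b * l')).
  by rewrite [RHS]addrC -em ll; ring.
have nn : n = n'.
  apply: (mulfI a_neq0); apply: (addrI (b * m' + c * l')).
  by rewrite [RHS]addrC addrA -en ll mm; ring.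
by rewrite ll mm nn.
Qed.

(** Modulo [lambda J], the two families differ by whether the last basis vector
    is reached from the third one; when it is, the product of the two off-block
    entries is an invariant, here equal to [mu]. *)
Lemma canonical_second_unique_3 {F : fieldType} (C D : 'M[F]_4) :
  canonical_second 3 C -> canonical_second 3 D ->
  pair_similar (jordan4 F 3, C) (jordan4 F 3, D) -> C = D.
Proof.
have shape (C1 D1 : 'M[F]_4) :
    pair_similar (jordan4 F 3, C1) (jordan4 F 3, D1) ->
    exists a b c d e f, a != 0 /\
      let X := mx4 [:: [:: a; b; c; d]; [:: 0; a; b; 0];
                       [:: 0; 0; a; 0]; [:: 0; 0; e; f]] in
      C1 *m X = X *m D1.
  case/pair_similar_elim=> X [uX /= hJ hC].
  have [a [b [c [d [e [f eX]]]]]] := centralizer_jordan4_3 X hJ.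
  exists a, b, c, d, e, f; rewrite -eX; split=> //.
  by apply: contraTneq uX => a0; rewrite eX a0 unitmx_col0_neq0.
have distinct l m l' : ~ pair_similar
    (jordan4 F 3, mx4 [:: [:: 0; l; 0; m]; [:: 0; 0; l; 0];
                          [:: 0; 0; 0; 0]; [:: 0; 0; 1; 0]])
    (jordan4 F 3, mx4 [:: [:: 0; l'; 0; 1]; [:: 0; 0; l'; 0];
                          [:: 0; 0; 0; 0]; [:: 0; 0; 0; 0]]).
  move/shape=> [a [b [c [d [e [f [a0 /=]]]]]]].
  rewrite !mulmx_mx4 !simpmx => /mx4_inj[_ _ _ [_ _ a_eq0 _]].
  by rewrite a_eq0 eqxx in a0.
case=> [[l [m ->]]|[l ->]] [[l' [m' ->]]|[l' ->]] sim.
- have [a [b [c [d [e [f [a0 /=]]]]]]] := shape _ _ sim.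
  rewrite !mulmx_mx4 !simpmx => /mx4_inj[[_ el _ em] _ _ [_ _ af _]].
  have -> : l = l' by apply: (mulfI a0); rewrite -el mulrC.
  by have -> : m = m' by apply: (mulfI a0); rewrite -em -af mulrC.
- by case: (distinct _ _ _ sim).
- by case: (distinct _ _ _ (pair_similar_sym sim)).
- have [a [b [c [d [e [f [a0 /=]]]]]]] := shape _ _ sim.
  rewrite !mulmx_mx4 !simpmx => /mx4_inj[[_ el _ _] _ _ _].
  by have -> : l = l' by apply: (mulfI a0); rewrite -el mulrC.
Qed.

(** The families are separated by the action on the quotient by the image of
    [J], nilpotent and nonzero for the first family, zero for the second.
    Within the first family the trace of the part [q] of [B = p + q t] and its
    lower left entry are preserved; within the second one, the eigenvalue of
    [q]. *)
Lemma canonical_second_unique_2 {F : fieldType} (C D : 'M[F]_4) :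
  canonical_second 2 C -> canonical_second 2 D ->
  pair_similar (jordan4 F 2, C) (jordan4 F 2, D) -> C = D.
Proof.
have shape (C1 D1 : 'M[F]_4) :
    pair_similar (jordan4 F 2, C1) (jordan4 F 2, D1) ->
    exists p1 p2 p3 p4 q1 q2 q3 q4, ~ (p1 = 0 /\ p3 = 0) /\
      let X := mx4 [:: [:: p1; q1; p2; q2]; [:: 0; p1; 0; p2];
                       [:: p3; q3; p4; q4]; [:: 0; p3; 0; p4]] in
      C1 *m X = X *m D1.
  case/pair_similar_elim=> X [uX /= hJ hC].
  have [p1 [p2 [p3 [p4 [q1 [q2 [q3 [q4 eX]]]]]]]] := centralizer_jordan4_2 X hJ.
  exists p1, p2, p3, p4, q1, q2, q3, q4; rewrite -eX; split=> //.
  by case=> p10 p30; move: uX; rewrite eX p10 p30; apply/negP/unitmx_col0_neq0.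
have distinct l m l' : ~ pair_similar
    (jordan4 F 2, mx4 [:: [:: 0; l'; 0; 1]; [:: 0; 0; 0; 0];
                          [:: 0; 0; 0; l']; [:: 0; 0; 0; 0]])
    (jordan4 F 2, mx4 [:: [:: 0; 0; 1; 0]; [:: 0; 0; 0; 1];
                          [:: 0; l; 0; m]; [:: 0; 0; 0; 0]]).
  move/shape=> [p1 [p2 [p3 [p4 [q1 [q2 [q3 [q4 [p0 /=]]]]]]]]].
  rewrite !mulmx_mx4 !simpmx => /mx4_inj[[_ _ p10 _] _ [_ _ p30 _] _].
  by apply: p0.
case=> [[l [m ->]]|[l ->]] [[l' [m' ->]]|[l' ->]] sim.
- have [p1 [p2 [p3 [p4 [q1 [q2 [q3 [q4 [p0 /=]]]]]]]]] := shape _ _ sim.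
  rewrite !mulmx_mx4 !simpmx.
  case/mx4_inj=> -[p30 e1 p41 _] _ [_ e2 _ e3] _.
  have p1_neq0 : p1 != 0 by apply/eqP=> p10; apply: p0.
  rewrite p30 p41 mulr0 addr0 in e1 e2 e3.
  have ll : l = l' by apply: (mulfI p1_neq0); rewrite -e2 mulrC.
  have -> : m = m'; last by rewrite ll.
  apply: (mulfI p1_neq0); apply: (addrI (p2 * l')).
  by rewrite -{2}e1 -e3 ll; ring.
- by case: (distinct _ _ _ (pair_similar_sym sim)).
- by case: (distinct _ _ _ sim).
- have [p1 [p2 [p3 [p4 [q1 [q2 [q3 [q4 [p0 /=]]]]]]]]] := shape _ _ sim.
  rewrite !mulmx_mx4 !simpmx => /mx4_inj[[_ e1 _ _] _ [_ e3 _ _] _].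
  have [->//|neq] := eqVneq l l'.
  have {}neq : l - l' != 0 by rewrite subr_eq0.
  have p30 : p3 = 0.
    by apply: (mulfI neq); rewrite mulr0 mulrBl e3; ring.
  case: p0; split=> //.
  by apply: (mulfI neq); rewrite mulr0 mulrBl -[l * p1]addr0 -{1}p30 e1; ring.
Qed.

(** For two different families, an entry of [C *m X = X *m D] equates the
    diagonal entry [a] of the intertwiner, which cannot vanish, with an entry
    that does. Similarity being symmetric, each two families are compared in
    the order for which this happens. *)
Lemma canonical_second_unique_1 {F : fieldType} (C D : 'M[F]_4) :
  canonical_second 1 C -> canonical_second 1 D ->
  pair_similar (jordan4 F 1, C) (jordan4 F 1, D) -> C = D.
Proof.
have shape (C1 D1 : 'M[F]_4) :
    pair_similar (jordan4 F 1, C1) (jordan4 F 1, D1) ->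
    exists a b u1 u2 v1 v2 d1 d2 d3 d4, a != 0 /\
      let X := mx4 [:: [:: a; b; u1; u2]; [:: 0; a; 0; 0];
                       [:: 0; v1; d1; d2]; [:: 0; v2; d3; d4]] in
      C1 *m X = X *m D1.
  case/pair_similar_elim=> X [uX /= hJ hC].
  have [a [b [u1 [u2 [v1 [v2 [d1 [d2 [d3 [d4 eX]]]]]]]]]] :=
    centralizer_jordan4_1 X hJ.
  exists a, b, u1, u2, v1, v2, d1, d2, d3, d4; rewrite -eX; split=> //.
  by apply: contraTneq uX => a0; rewrite eX a0 unitmx_col0_neq0.
have distinct12 l : ~ pair_similar
    (jordan4 F 1, mx4 [:: [:: 0; 0; l; 0]; [:: 0; 0; 0; 0];
                          [:: 0; 0; 0; 1]; [:: 0; 1; 0; 0]])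
    (jordan4 F 1, mx4 [:: [:: 0; 0; 1; 0]; [:: 0; 0; 0; 0];
                          [:: 0; 0; 0; 1]; [:: 0; 0; 0; 0]]).
  move/shape=> [a [b [u1 [u2 [v1 [v2 [d1 [d2 [d3 [d4 [a0 /=]]]]]]]]]]].
  rewrite !mulmx_mx4 !simpmx => /mx4_inj[_ _ _ [_ a_eq0 _ _]].
  by rewrite a_eq0 eqxx in a0.
have distinct13 l : ~ pair_similar
    (jordan4 F 1, mx4 [:: [:: 0; 0; l; 0]; [:: 0; 0; 0; 0];
                          [:: 0; 0; 0; 1]; [:: 0; 1; 0; 0]])
    (jordan4 F 1, mx4 [:: [:: 0; 0; 1; 0]; [:: 0; 0; 0; 0];
                          [:: 0; 0; 0; 0]; [:: 0; 1; 0; 0]]).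
  move/shape=> [a [b [u1 [u2 [v1 [v2 [d1 [d2 [d3 [d4 [a0 /=]]]]]]]]]]].
  rewrite !mulmx_mx4 !simpmx => /mx4_inj[_ _ [_ _ _ d40] [_ a_eq _ _]].
  by rewrite a_eq d40 eqxx in a0.
have distinct32 : ~ pair_similar
    (jordan4 F 1, mx4 [:: [:: 0; 0; 1; 0]; [:: 0; 0; 0; 0];
                          [:: 0; 0; 0; 0]; [:: 0; 1; 0; 0]])
    (jordan4 F 1, mx4 [:: [:: 0; 0; 1; 0]; [:: 0; 0; 0; 0];
                          [:: 0; 0; 0; 1]; [:: 0; 0; 0; 0]]).
  move/shape=> [a [b [u1 [u2 [v1 [v2 [d1 [d2 [d3 [d4 [a0 /=]]]]]]]]]]].
  rewrite !mulmx_mx4 !simpmx => /mx4_inj[_ _ _ [_ a_eq0 _ _]].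
  by rewrite a_eq0 eqxx in a0.
case=> [[l ->]|->|->] [[l' ->]|->|->] sim //.
- have [a [b [u1 [u2 [v1 [v2 [d1 [d2 [d3 [d4 [a0 /=]]]]]]]]]]] := shape _ _ sim.
  rewrite !mulmx_mx4 !simpmx => /mx4_inj[[_ _ el _] _ [_ _ _ ed] [_ ea _ _]].
  by have -> : l = l' by apply: (mulfI a0); rewrite -el -ed -ea mulrC.
- by case: (distinct12 _ sim).
- by case: (distinct13 _ sim).
- by case: (distinct12 _ (pair_similar_sym sim)).
- by case: (distinct32 (pair_similar_sym sim)).
- by case: (distinct13 _ (pair_similar_sym sim)).
Qed.

Lemma canonical_pair_unique {F : fieldType} (P Q : mxpair F 4) :
  canonical_pair P -> canonical_pair Q -> pair_similar P Q -> P = Q.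
Proof.
case/canonical_pair_jordan4=> k [C [k5 -> hC]].
case/canonical_pair_jordan4=> k' [D [k'5 -> hD]] sim.
have not_lt i j (C1 D1 : 'M[F]_4) : (i < j < 5)%N ->
    ~ pair_similar (jordan4 F i, C1) (jordan4 F j, D1).
  move=> lt /pair_similar_elim[X [uX /= hX _]].
  by have := jordan4_intertwiner i j X lt hX; rewrite uX.
have [lt|lt|e] := ltngtP k k'.
- by case: (not_lt k k' C D); rewrite ?lt.
- by case: (not_lt k' k D C); rewrite ?lt //; apply: pair_similar_sym.
move: hC sim k5; rewrite {}e => hC sim _; congr (_, _); move: k'5 hC hD sim.
case: k' => [|[|[|[|[|//]]]]] _.
- by move=> -> ->.
- exact: canonical_second_unique_1.
- exact: canonical_second_unique_2.
- exact: canonical_second_unique_3.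
- exact: canonical_second_unique_4.
Qed.

Theorem theorem2p1 (F : closedFieldType) (A B : 'M[F]_4)
    (hcn : commuting_nilpotent_pair (A, B))
    (hind : indecomposable_pair (A, B)) :
  exists! Q : mxpair F 4, canonical_pair Q /\ pair_similar (A, B) Q.
Proof.
have [A4 _ _] := hcn; case: hind => _ not_dec.
have [X [k [uX k5 AX]]] := nilpotent_jordan4 A A4.
have sim : pair_similar (A, B) (jordan4 F k, invmx X *m B *m X).
  by apply: (pair_similar_intro _ _ X) => //=; rewrite -mulmxA mulKVmx.
have hcn' := commuting_nilpotent_similar sim hcn.
have hcl : classified (jordan4 F k, invmx X *m B *m X).
  case: k k5 {AX sim} hcn' => [|[|[|[|[|//]]]]] _.
  - exact: classified_jordan4_0.
  - exact: classified_jordan4_1.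
  - exact: classified_jordan4_2.
  - exact: classified_jordan4_3.
  - exact: classified_jordan4_4.
have [//|[Q [cQ simQ]]] := classified_similar sim hcl.
exists Q; split=> // R [cR simR].
apply: canonical_pair_unique => //.
exact: pair_similar_trans (pair_similar_sym simQ) simR.
Qed.
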